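(* There is a constant $c>0$ such that for every $k\ge2$ and every $n\ge3$, Duplicator has a strategy in the bijective $k$-walk pebble game played on $X(G^2_n)$ and $\tilde X(G^2_n)$ such that Spoiler does not win within the first $c\,n$ rounds (i.e., Spoiler wins in $\Omega(n)$ rounds at the earliest).
   Context: $G^2_n$ is the $2\times n$ grid graph (vertices $(i,j)$, $i\in\{1,2\}$, $j\in[n]$, adjacent iff they differ by one in exactly one coordinate) with one additional vertex of degree $1$ attached to one corner. CFI-type construction for a connected simple base graph $G$: fix for each base vertex $v$ an ordering of its incident edges. Replace each base vertex $v$ of degree $d$ by the gadget $F(v)=\{v(a_1,\dots,a_d): (a_1,\dots,a_d)\in\{0,1\}^d \text{ with an even number of ones}\}$, an independent set. For each base edge $\{u,v\}$ that is the $i$-th edge at $u$ (degree $d$) and the $j$-th edge at $v$ (degree $d'$), add all edges $\{u(a_1,\dots,a_d),v(b_1,\dots,b_{d'})\}$ with $a_i=b_j$. The result is the undirected graph $X(G)$. $\tilde X(G)$ is obtained from $X(G)$ by twisting one base edge $\{u,v\}$, i.e. replacing adjacency by non-adjacency and vice versa for all pairs between $F(u)$ and $F(v)$; up to isomorphism this does not depend on the chosen edge. Bijective $k$-walk pebble game on $G_1=(V_1,E_1)$, $G_2=(V_2,E_2)$: pebble pairs $(p_i,q_i)$, $i\in[k+1]$; pairs $i,i+1$ ($i\in[k]$) and $k+1,1$ are consecutive. If $|V_1|\ne|V_2|$ Spoiler wins immediately; otherwise pebbles start beside the graphs. Each round: (1) if pebbles are on the graphs, Spoiler chooses a pair $(p_i,q_i)$,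 relabels it $(p_1,q_1)$ and relabels the next consecutive pair, if placed, $(p_{k+1},q_{k+1})$, then removes all other pairs; (2) Duplicator chooses a bijection $f\colon V_1^{k-1}\to V_2^{k-1}$; (3) Spoiler chooses $(u_2,\dots,u_k)\in V_1^{k-1}$, places $p_i$ on $u_i$ and $q_i$ on $v_i$ where $f(u_2,\dots,u_k)=(v_2,\dots,v_k)$. Spoiler wins after a round if some consecutive pebble pairs lie on $(a,b)\in V_1^2$ and $(a',b')\in V_2^2$ such that $a\mapsto a',b\mapsto b'$ is not an isomorphism between the subgraphs induced on $\{a,b\}$ and $\{a',b'\}$. *)

(* Defs.v *)
From mathcomp Require Import all_boot all_order all_algebra.

Set Implicit Arguments.
Unset Strict Implicit.
Unset Printing Implicit Defensive.

(* A finite simple graph is a finType with a symmetric irreflexive relation. *)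

Definition differ_by_one (a b : nat) : bool := (a.+1 == b) || (b.+1 == a).

(* [Some (i, j)] are the grid vertices (0-based), [None] is the additional
   vertex of degree 1, attached to the corner (0, 0).  The corners of the grid
   are equivalent under its automorphisms. *)
Definition grid_vertex (n : nat) : finType := option ('I_2 * 'I_n)%type.

Definition grid_adj (n : nat) : rel (grid_vertex n) := fun x y =>
  match x, y with
  | Some (i, j), Some (i', j') =>
      (differ_by_one i i' && (j == j')) || ((i == i') && differ_by_one j j')
  | Some (i, j), None | None, Some (i, j) =>
      (i == 0 :> nat) && (j == 0 :> nat)
  | None, None => false
  end.

Lemma grid_adj_sym n : symmetric (@grid_adj n).
Proof.
move=> [[i j]|] [[i' j']|] //=.
by rewrite /differ_by_one (eq_sym j) (eq_sym i) [X in X && _]orbC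
   [X in _ || (_ && X)]orbC.
Qed.

Lemma grid_adj_irr n : irreflexive (@grid_adj n).
Proof.
move=> [[i j]|] //=.
by rewrite /differ_by_one !orbb (gtn_eqF (ltnSn i)) (gtn_eqF (ltnSn j)) andbF.
Qed.

Section CFI.

Variables (V : finType) (e : rel V).

(* In a simple graph the edges incident to [v] correspond to the neighbours of
   [v], so an ordering of these edges is a duplicate-free list [nb v] of the
   neighbours. *)
Definition edge_ordering (nb : V -> seq V) : Prop :=
  forall v : V, uniq (nb v) /\ nb v =i e v.

Variable nb : V -> seq V.

(* [Tagged _ a] over [v] is the gadget vertex v(a_1, ..., a_d), d = deg v. *)
Definition cfi_vertex : finType :=
  {x : {v : V & (size (nb v)).-tuple bool} | ~~ odd (count id (tagged x))}.

Definition cfi_base (x : cfi_vertex) : V := tag (val x).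

(* The bit of [x] at the position of the edge {cfi_base x, w} in the ordering
   at [cfi_base x]. *)
Definition cfi_bit (x : cfi_vertex) (w : V) : bool :=
  nth false (tagged (val x)) (index w (nb (cfi_base x))).

Definition cfi_adj : rel cfi_vertex := fun x y =>
  e (cfi_base x) (cfi_base y) &&
  (cfi_bit x (cfi_base y) == cfi_bit y (cfi_base x)).

Definition between_gadgets (s t : V) : rel cfi_vertex := fun x y =>
  ((cfi_base x == s) && (cfi_base y == t)) ||
  ((cfi_base x == t) && (cfi_base y == s)).

Definition twisted_cfi_adj (s t : V) : rel cfi_vertex := fun x y =>
  if between_gadgets s t x y then ~~ cfi_adj x y else cfi_adj x y.

Lemma cfi_adj_sym : symmetric e -> symmetric cfi_adj.
Proof. by move=> es x y; rewrite /cfi_adj es eq_sym. Qed.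

Lemma cfi_adj_irr : irreflexive e -> irreflexive cfi_adj.
Proof. by move=> ei x; rewrite /cfi_adj ei. Qed.

Lemma twisted_cfi_adj_sym s t : symmetric e -> symmetric (twisted_cfi_adj s t).
Proof.
move=> es x y; rewrite /twisted_cfi_adj (cfi_adj_sym es x).
by rewrite /between_gadgets orbC andbC [X in _ || X]andbC.
Qed.

Lemma twisted_cfi_adj_irr s t :
  irreflexive e -> e s t -> irreflexive (twisted_cfi_adj s t).
Proof.
move=> ei est x; rewrite /twisted_cfi_adj (cfi_adj_irr ei) /between_gadgets.
rewrite [X in _ || X]andbC orbb; case: eqP => //= ->.
by case: eqP => // eq_st; rewrite eq_st ei in est.
Qed.

End CFI.

Section WalkPebbleGame.

Variables (k : nat) (V1 V2 : finType) (E1 : rel V1) (E2 : rel V2).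

(* Pebble pairs are indexed from 0 to k instead of from 1 to k + 1, so the
   pair consecutive to [i] is [ordS i], which wraps around from [ord_max] to
   [ord0].  [None] means that the pair is beside the graphs. *)
Definition position : finType := {ffun 'I_k.+1 -> option (V1 * V2)%type}.

Definition no_pebbles : position := [ffun=> None].

Definition keep_pair (p : position) (i : 'I_k.+1) : position :=
  [ffun j => if j == ord0 then p i
             else if j == ord_max then p (ordS i)
             else None].

Definition spoiler_picks (p p' : position) : Prop :=
  (p = no_pebbles /\ p' = p) \/ (exists2 i, p i <> None & p' = keep_pair p i).

(* [u] and [w] are indexed from 0: their j-th entries are the vertices for the
   pebble pair with (0-based) index j + 1, that is the pairs other than the
   first and the last one. *)
Definition place (p : position) (u : k.-1.-tuple V1) (w : k.-1.-tuple V2) :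
    position :=
  [ffun j : 'I_k.+1 => if 0 < j < k then onth (zip u w) j.-1 else p j].

(* For simple graphs: a |-> a', b |-> b' is an isomorphism between the
   subgraphs induced on {a, b} and {a', b'}. *)
Definition pair_iso (a b : V1) (a' b' : V2) : Prop :=
  (a == b) = (a' == b') /\ E1 a b = E2 a' b'.

Definition spoiler_won (p : position) : Prop :=
  exists (i : 'I_k.+1) (a b : V1) (a' b' : V2),
    [/\ p i = Some (a, a'), p (ordS i) = Some (b, b') & ~ pair_iso a b a' b'].

(* [sigma h p] is the map chosen by Duplicator in step (2) when [h] lists the
   positions before the current and all previous rounds (most recent first)
   and [p] is the position after step (1) of the current round. *)
Definition strategy : Type :=
  seq position -> position -> k.-1.-tuple V1 -> k.-1.-tuple V2.

(* [play sigma h p]: some play following [sigma] reaches [p] after [size h]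
   rounds, [h] listing the positions before these rounds.  Spoiler having won
   does not stop a play, which is harmless in [duplicator_survives] as all
   its intermediate positions are plays too. *)
Inductive play (sigma : strategy) : seq position -> position -> Prop :=
| play_start : play sigma [::] no_pebbles
| play_round (h : seq position) (p p' : position) (u : k.-1.-tuple V1) :
    play sigma h p -> spoiler_picks p p' ->
    play sigma (p :: h) (place p' u (sigma (p :: h) p' u)).

(* Duplicator has a strategy with which Spoiler does not win within the first
   [t] rounds; Spoiler wins immediately if the graphs differ in order. *)
Definition duplicator_survives (t : rat) : Prop :=
  #|V1| = #|V2| /\
  exists2 sigma : strategy,
    forall h p, bijective (sigma h p)
  & forall h p, play sigma h p -> ((size h)%:R <= t)%R -> ~ spoiler_won p.

End WalkPebbleGame.

(* Main.v *)
Require Import Defs.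
From mathcomp Require Import all_boot all_order all_algebra.
From mathcomp Require Import zify lra.

(* Duplicator always answers by translating gadgets: over a base vertex v she
   adds an even vector to the bits at v, so only the two bits added towards
   the left and right neighbours of v matter.  They are recorded relative to a
   fixed assignment that moves the twist from {s, t} to the last rung.  Two
   consecutive pebbles in different rows and in the same or adjacent columns
   separate the ladder; their bits then tell on which side the twist is hidden,
   and the position is safe for r rounds if that side has more than r columns.
   When Spoiler lays a closed walk of pebbles, the bit for the cut between
   columns j and j + 1 is carried along only while the walk stays in these two
   columns, and it is unconstrained once the walk leaves them.  So the two old
   pebbles constrain the answer only if the whole walk lies in two adjacent
   columns; in that case every separating pair keeps the old side, which shrinks
   by at most one column.  In all other cases the twist is put into the larger
   half.  Hence Duplicator survives about n / 2 rounds, for every k. *)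

Set Implicit Arguments.
Unset Strict Implicit.
Unset Printing Implicit Defensive.

(** * Answering a walk on the ladder *)

(* A base vertex is given as (row, column): the pendant vertex is (false, 0) and
   the grid occupies columns 1 to n. *)
Definition close (v w : bool * nat) : bool := (v.2 <= w.2.+1) && (w.2 <= v.2.+1).

(* The bits x.1 and x.2 belong to the cuts to the left and to the right of v.
   There is no edge on the left of (true, 1), and the edge at the pendant vertex
   is never flipped; on the right of column n, where there is no edge either,
   the bit [v.1] encodes that the reference twist sits on the last rung. *)
Definition valid (n : nat) (v : bool * nat) (x : bool * bool) : bool :=
  [&& (v.2 <= 1) ==> ~~ x.1, (v.2 == 0) ==> ~~ x.2 & (v.2 == n) ==> (x.2 == v.1)].

(* [s] says that the twist is to the left of the pair v, w. *)
Definition side_ok (n r : nat) (v w : bool * nat) (s : bool) : bool :=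
  if v.1 == w.1 then ~~ s
  else if s then r.+1 < minn v.2 w.2 else maxn v.2 w.2 + r < n.

(** Vertices in one column share both cuts, vertices in adjacent columns only the cut between them.
    The same [s] is required at every shared cut. *)
Definition bits_differ (v : bool * nat) (x : bool * bool)
    (w : bool * nat) (y : bool * bool) (s : bool) : bool :=
  [&& (v.2 == w.2) ==> ((x.1 (+) y.1 == s) && (x.2 (+) y.2 == s)),
      (v.2.+1 == w.2) ==> (x.2 (+) y.1 == s)
    & (w.2.+1 == v.2) ==> (x.1 (+) y.2 == s)].

Definition link (n r : nat) v x w y : bool :=
  close v w ==> [exists s : bool, side_ok n r v w s && bits_differ v x w y s].

Lemma link_sym n r v x w y : link n r v x w y = link n r w y v x.
Proof.
rewrite /link /close andbC; congr (_ ==> _); apply: eq_existsb => s.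
rewrite /side_ok /bits_differ eq_sym minnC maxnC; congr (_ && _).
rewrite (eq_sym v.2) [y.1 (+) _]addbC [y.2 (+) x.2]addbC.
rewrite [y.1 (+) _]addbC [y.2 (+) x.1]addbC.
by congr (_ && _); rewrite andbC.
Qed.

Lemma link_refl n r v x : link n r v x v x.
Proof.
apply/implyP => _; apply/existsP; exists false.
rewrite /side_ok /bits_differ !eqxx !addbb /=.
by rewrite (gtn_eqF (ltnSn _)).
Qed.

Lemma link_weaken n r v x w y : link n r.+1 v x w y -> link n r v x w y.
Proof.
move=> /implyP lk; apply/implyP => /lk /existsP [s /andP [ok bd]].
apply/existsP; exists s; rewrite bd andbT; move: ok; rewrite /side_ok.
by case: ifP => // _; case: s {bd}; lia.
Qed.

(** Cut [j] lies between columns [j - 1] and [j], so column [c] has cut [c] on its left and cut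
    [c.+1] on its right. *)
Definition borders (j c : nat) : bool := (c == j) || (c.+1 == j).

Lemma borders_bounds j c : borders j c = (c <= j <= c.+1).
Proof. by rewrite /borders; lia. Qed.

Definition bit_at (x : bool * bool) (c j : nat) : bool :=
  if j == c then x.1 else x.2.

Lemma bits_differ_at v x w y s j :
  bits_differ v x w y s -> borders j v.2 -> borders j w.2 ->
  bit_at x v.2 j (+) bit_at y w.2 j = s.
Proof.
case/and3P=> b1 b2 b3 jv jw; rewrite /bit_at.
move: b1 b2 b3 jv jw; rewrite /borders.
case: (x) (y) => x1 x2 [y1 y2] /=.
case: (ltngtP v.2 w.2) => [lt|gt|eq] /=; rewrite ?eq.
- move=> _ /implyP b _ /orP [/eqP|/eqP] h1 /orP [/eqP|/eqP] h2; try lia.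
  have -> : (j == v.2) = false by lia.
  have -> : (j == w.2) by lia.
  by apply/eqP/b; lia.
- move=> _ _ /implyP b /orP [/eqP|/eqP] h1 /orP [/eqP|/eqP] h2; try lia.
  have -> : (j == v.2) by lia.
  have -> : (j == w.2) = false by lia.
  by apply/eqP/b; lia.
- by move=> /andP[/eqP b1 /eqP b2] _ _ _ _; case: ifP.
Qed.

Lemma boundary_bits n v x j : v.2 <= n -> valid n v x -> borders j v.2 ->
  (j <= 1 -> bit_at x v.2 j = false) /\ (j = n.+1 -> bit_at x v.2 j = v.1).
Proof.
move=> vn /and3P [v1 v2 v3]; rewrite /borders /bit_at => /orP [] /eqP <-.
  rewrite eqxx; split=> [j1|e]; first by move: v1; rewrite j1 => /negbTE.
  by move: vn; rewrite e ltnn.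
rewrite (gtn_eqF (ltnSn _)); split=> [|[e]]; last by move: v3; rewrite e eqxx => /eqP.
by rewrite ltnS leqn0 => v0; move: v2; rewrite v0 => /negbTE.
Qed.

(* V j i is the bit of cut j at time i.  It is obtained from the partial sums S
   of the sides by adding a constant on each time interval that the walk spends
   in the columns around the cut; the constant is fixed by the end y or the
   start x if the interval reaches it. *)
Lemma walk_response n r k (g : nat -> bool * nat) (x y : bool * bool) :
  r.+2 < n./2 -> (forall t, (g t).2 <= n) ->
  valid n (g 0) x -> valid n (g k) y ->
  link n r.+1 (g 0) x (g k) y ->
  exists D : nat -> bool * bool,
    [/\ D 0 = x, D k = y, forall t, valid n (g t) (D t) &
        forall t, t < k -> link n r (g t) (D t) (g t.+1) (D t.+1)].
Proof.
move=> hr gn vx vy /implyP lk.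
(* The default [false] is harmless: [sl] is consulted only on confined walks, whose ends are
   close. *)
have [sl hsl] : exists sl, close (g 0) (g k) ->
    side_ok n r.+1 (g 0) (g k) sl && bits_differ (g 0) x (g k) y sl.
  case: (boolP (close _ _)) lk => [_ /(_ isT) /existsP [sl h]|_ _];
    by [exists sl | exists false].
pose c t := (g t).2.
pose conf := [forall t : 'I_k.+1, forall u : 'I_k.+1, c t <= (c u).+1].
(* On a confined walk every row change uses the one side [s0]. If the ends lie in one row, the
   number of row changes is even and either side is consistent, so the larger half is taken;
   otherwise the old side is kept. *)
pose s0 := if (g 0).1 == (g k).1 then n./2 <= c 0 else sl.
pose s t := ((g t).1 != (g t.+1).1) &&
            (if conf then s0 else n./2 <= minn (c t) (c t.+1)).
have confP t u : conf -> t <= k -> u <= k -> c t <= (c u).+1.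
  move=> /forallP h tk uk; move: (h (Ordinal (tk : t < k.+1))) => /forallP.
  by move=> /(_ (Ordinal (uk : u < k.+1))).
have s_ok t : t < k -> close (g t) (g t.+1) -> side_ok n r (g t) (g t.+1) (s t).
  move=> tk /andP []; rewrite /side_ok -/(c t) -/(c t.+1) => c1 c2.
  rewrite /s; case: eqP => //= _.
  case: (boolP conf) => [cf|_]; last first.
    move: c1 c2 hr; clear; rewrite addn_maxl gtn_max !leq_min.
    by move: (c t) (c t.+1) => a b; case: (leqP n./2 a); case: (leqP n./2 b) => /=; lia.
  (* Confined columns differ from [c 0] by at most one, which is absorbed by the drop from [r.+1] to
     [r] or by the slack in [r.+2 < n./2]. *)
  have c0t := confP 0 t cf (leq0n _) (ltnW tk).
  have ct0 := confP t 0 cf (ltnW tk) (leq0n _).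
  have c0u := confP 0 t.+1 cf (leq0n _) tk.
  have cu0 := confP t.+1 0 cf tk (leq0n _).
  have cl : close (g 0) (g k) by rewrite /close -/(c 0) -/(c k) !confP.
  move: (hsl cl) => /andP [+ _]; rewrite /side_ok -/(c 0) -/(c k) /s0.
  rewrite !addn_maxl !gtn_max !leq_min.
  move: c0t ct0 c0u cu0 hr; clear; move: (c 0) (c t) (c t.+1) => p a b.
  by case: eqP => _; [case: (leqP n./2 p)|case: sl] => /=; lia.
pose S i := \big[addb/false]_(t < i) s t.
have S_rec t : S t (+) S t.+1 = s t.
  by rewrite /S big_ord_recr /= addKb.
have S_conf i : conf -> S i = s0 && ((g 0).1 (+) (g i).1).
  move=> cf; elim: i => [|i IH]; first by rewrite /S big_ord0 addbb andbF.
  rewrite /S big_ord_recr /= -/(S i) IH /s cf.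
  by case: (g 0).1 (g i).1 (g i.+1).1 (s0) => [] [] [] [].
pose tail j i := [forall t : 'I_k.+1, (i <= t) ==> borders j (c t)].
pose head j i := [forall t : 'I_k.+1, (t <= i) ==> borders j (c t)].
pose V j i := if j <= 1 then false else if j == n.+1 then (g i).1 else
  S i (+) (if tail j i then bit_at y (c k) j (+) S k
           else head j i && bit_at x (c 0) j).
have V_step j t : t < k -> close (g t) (g t.+1) ->
    borders j (c t) -> borders j (c t.+1) -> V j t (+) V j t.+1 = s t.
  move=> tk cl b1 b2; move: (s_ok t tk cl); rewrite /side_ok -/(c t) -/(c t.+1).
  (* At the outer cuts [V] is prescribed. There [s_ok] leaves no room for the twist beyond the cut,
     so [s t] vanishes on the left and equals the row change on the right. *)
  rewrite /V; case: (leqP j 1) => [j1|j2].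
    have ct : c t <= 1 by move: b1; rewrite borders_bounds => /andP [/leq_trans h _]; exact: h.
    case: (s t); case: eqP => //= _; rewrite leq_min => /andP [lt _].
    by have := leq_trans lt ct.
  case: (j =P n.+1) => [jn|_].
    have ct : n <= c t by move: b1; rewrite borders_bounds jn => /andP [].
    have /negbTE -> : ~~ (maxn (c t) (c t.+1) + r < n).
      by rewrite -leqNgt addn_maxl leq_max (leq_trans ct) ?leq_addr.
    by case: (g t).1 (g t.+1).1 => [] []; case: (s t).
  move=> _; have -> : tail j t.+1 = tail j t.
    apply: eq_forallb => u; case: (ltngtP t u) => //= tu.
    by rewrite -tu b1.
  have -> : head j t.+1 = head j t.
    apply: eq_forallb => u; rewrite leq_eqVlt ltnS.
    by case: eqP => //= ->; rewrite b2 ltnn.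
  by rewrite -S_rec; case: (S t) (S t.+1) (if _ then _ else _) => [] [] [].
have V0 j : borders j (c 0) -> V j 0 = bit_at x (c 0) j.
  move=> b0; have [lo hi] := boundary_bits (gn 0) vx b0; rewrite /V.
  case: (leqP j 1) => [j1|j2].
    by rewrite lo.
  case: (j =P n.+1) => [jn|_]; first by rewrite hi.
  rewrite {1}/S big_ord0 /=; case: ifP => [tl|_]; last first.
    have -> // : head j 0.
    by apply/forallP => t; apply/implyP; rewrite leqn0 => /eqP ->.
  (* The only possible conflict: the constant was chosen from [y], but the interval reaches back to
     time 0. Then the walk is confined, and the old link makes the change between [x] and [y] equal
     to [S k]. *)
  have all_b t : t <= k -> borders j (c t).
    by move=> tk; move/forallP: tl => /(_ (Ordinal (tk : t < k.+1))).
  have cf : conf.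
    apply/forallP => t; apply/forallP => u.
    have := all_b t (leq_ord t); have := all_b u (leq_ord u).
    rewrite !borders_bounds => /andP [_ ju] /andP [tj _].
    exact: leq_trans tj ju.
  have cl : close (g 0) (g k) by rewrite /close -/(c 0) -/(c k) !confP.
  move: (hsl cl) => /andP [ok bd].
  have := bits_differ_at bd (all_b 0 (leq0n _)) (all_b k (leqnn _)).
  rewrite S_conf // -/(c 0) -/(c k) /bit_at /s0.
  move: ok; rewrite /side_ok; case: eqP => [-> /negbTE ->|ne _ <-].
    by rewrite addbb andbF addbF; case: (if _ then _ else _) (if _ then _ else _) => [] [].
  have -> : (g 0).1 (+) (g k).1 by move: ne; case: (g 0).1 (g k).1 => [] [].
  by rewrite andbT; case: (if _ then _ else _) (if _ then _ else _) => [] [].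
have Vk j : borders j (c k) -> V j k = bit_at y (c k) j.
  move=> bk; have [lo hi] := boundary_bits (gn k) vy bk; rewrite /V.
  case: (leqP j 1) => [j1|j2].
    by rewrite lo.
  case: (j =P n.+1) => [jn|_]; first by rewrite hi.
  rewrite ifT; first by rewrite addbC addbK.
  apply/forallP => t; apply/implyP => kt.
  by have -> : val t = k by apply/eqP; rewrite eqn_leq kt leq_ord.
have bl t : borders (c t) (c t) by rewrite /borders eqxx.
have br t : borders (c t).+1 (c t) by rewrite /borders eqxx orbT.
exists (fun t => (V (c t) t, V (c t).+1 t)); split.
- by rewrite !V0 // /bit_at eqxx (gtn_eqF (ltnSn _)); case: (x).
- by rewrite !Vk // /bit_at eqxx (gtn_eqF (ltnSn _)); case: (y).
- move=> t; apply/and3P; split; apply/implyP; rewrite -/(c t) /V /=.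
  + by move=> ->.
  + by move=> /eqP ->.
  + move=> /eqP ->; rewrite eqxx ifF // ltnS leqn0.
    by case: (n) hr.
- move=> t tk; apply/implyP => cl; apply/existsP; exists (s t).
  rewrite s_ok //=; apply/and3P; split; apply/implyP => /eqP e /=.
  + by rewrite -/(c t) -/(c t.+1) in e; rewrite -e !V_step ?eqxx // -?e.
  + by rewrite -/(c t) -/(c t.+1) in e; rewrite e V_step ?eqxx // -?e.
  + by rewrite -/(c t) -/(c t.+1) in e; rewrite e V_step ?eqxx // -?e.
Qed.

(** * Flipping gadgets *)

Section Flip.

Variables (V : finType) (nb : V -> seq V).
Implicit Types (F : V -> V -> bool) (x : cfi_vertex nb).

Definition flip_tuple v (f : V -> bool) (a : (size (nb v)).-tuple bool) :
    (size (nb v)).-tuple bool :=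
  [tuple of [seq b.1 (+) f b.2 | b <- zip a (in_tuple (nb v))]].

Lemma flip_tupleK v f : involutive (@flip_tuple v f).
Proof.
move=> a; apply/val_inj => /=; move: (tval a) (size_tuple a) => l.
elim: l (nb v) => [|b s IH] [|w r] //= [sz].
by rewrite addbK IH.
Qed.

Lemma odd_count_flip v f (a : (size (nb v)).-tuple bool) :
  odd (count id (flip_tuple f a)) = odd (count id a) (+) odd (count f (nb v)).
Proof.
rewrite /flip_tuple /=; move: (tval a) (size_tuple a) => l.
elim: l (nb v) => [|b s IH] [|w r] //= [sz].
rewrite !oddD IH // !oddb !addbA; congr (_ (+) _).
by rewrite addbAC.
Qed.

Definition flip_tagged F (z : {v : V & (size (nb v)).-tuple bool}) :=
  Tagged (fun v => (size (nb v)).-tuple bool)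
    (flip_tuple (F (tag z)) (tagged z)).

Lemma flip_taggedK F : involutive (flip_tagged F).
Proof. by case=> v a; rewrite /flip_tagged /= flip_tupleK. Qed.

(* The identity on the gadgets where F flips an odd number of bits. *)
Definition flip F x : cfi_vertex nb := insubd x (flip_tagged F (val x)).

Lemma val_flip F x :
  val (flip F x) = if odd (count (F (cfi_base x)) (nb (cfi_base x))) then val x
    else flip_tagged F (val x).
Proof.
by rewrite /flip val_insubd /= odd_count_flip (negbTE (valP x)) /= if_neg.
Qed.

Lemma base_flip F x : cfi_base (flip F x) = cfi_base x.
Proof. by rewrite /cfi_base val_flip; case: ifP. Qed.

Lemma flipK F : involutive (flip F).
Proof.
move=> x; apply/val_inj; rewrite val_flip base_flip val_flip.
by case: (odd _); rewrite ?flip_taggedK.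
Qed.

Lemma bit_flip F x w : ~~ odd (count (F (cfi_base x)) (nb (cfi_base x))) ->
  w \in nb (cfi_base x) ->
  cfi_bit (flip F x) w = cfi_bit x w (+) F (cfi_base x) w.
Proof.
move=> /negbTE ev wx; rewrite /cfi_bit {1 2}/cfi_base val_flip ev /=.
have sz : size (tagged (val x)) = size (nb (cfi_base x)) by rewrite size_tuple.
have lt : index w (nb (cfi_base x)) < size (nb (cfi_base x)) by rewrite index_mem.
rewrite (nth_map (false, w)) ?size_zip ?sz ?minnn // nth_zip ?sz //=.
by rewrite nth_index.
Qed.

End Flip.

(** * The reference assignment along the ladder *)

Definition ladder_adj (v w : bool * nat) : bool :=
  if v.1 == w.1 then differ_by_one v.2 w.2 else v.2 == w.2.

(** With a boolean read as a number, [v.1 <= v.2] excludes only the absent vertex [(true, 0)]. *)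
Definition on_ladder (n : nat) (v : bool * nat) : bool := v.1 <= v.2 <= n.

(* The reference assignment moves the twist from the edge {s, t} to the right
   along a row: the row of the edge if it is horizontal, row false if not. *)
Definition twist_flip (n : nat) (s t : bool * nat) (x : bool * bool)
    (v w : bool * nat) : bool :=
  let start := minn s.2 t.2 in
  let horizontal := s.1 == t.1 in
  let on_path := v.1 == (horizontal && s.1) in
  let left := x.1 (+) (on_path && (start < v.2)) in
  let right := if v.2 == n then false
               else x.2 (+) (on_path && (start + horizontal <= v.2)) in
  if w.2 < v.2 then left else if v.2 < w.2 then right else left (+) right.

(** On a row edge the link forces equal cut bits, and the path terms cancel except on a twisted
    edge, where only the right end is flipped. On a rung the two cut bits differ by the same amount
    and cancel; the last rung has no right bit, and the parity left over is the reference twist. *)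
Lemma twist_flip_edge n r s t x v y w :
  on_ladder n s -> on_ladder n t -> ladder_adj s t ->
  on_ladder n v -> on_ladder n w -> ladder_adj v w ->
  valid n v x -> valid n w y -> link n r v x w y ->
  twist_flip n s t x v w (+) twist_flip n s t y w v =
    (v == s) && (w == t) || (v == t) && (w == s).
Proof.
move=> hs ht st.
have horiz v' w' x' y' : v'.1 = w'.1 -> v'.2.+1 = w'.2 ->
    on_ladder n v' -> on_ladder n w' -> link n r v' x' w' y' ->
    twist_flip n s t x' v' w' (+) twist_flip n s t y' w' v' =
    (v' == s) && (w' == t) || (v' == t) && (w' == s).
  move=> rr cc lv lw /implyP lk.
  have cl : close v' w' by rewrite /close -cc leqnn andbT leqW.
  case/existsP: (lk cl) => b /andP []; rewrite /side_ok rr eqxx => /negbTE ->.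
  case/and3P=> _ /implyP /(_ (introT eqP cc)) /eqP e _.
  rewrite /twist_flip rr -cc ltnSn ltnNge leqnSn /=.
  have -> : y'.1 = x'.2 by move: e; case: x'.2 y'.1 => [] [].
  have -> : (v'.2 == n) = false by move: lw; rewrite /on_ladder; lia.
  case: s t v' w' {e lk cl} hs ht st lv lw rr cc => [s1 s2] [t1 t2] [v1 v2] [w1 w2].
  rewrite /on_ladder /ladder_adj /differ_by_one /= => hs ht st lv lw -> <- {w2 lw v1 lv}.
  rewrite !xpair_eqE.
  case: s1 t1 w1 x'.2 hs ht st => [] [] [] [] /=; lia.
move=> lv lw; rewrite {1}/ladder_adj; case: eqP => [e|ne].
  case/orP => /eqP c vx wy lk; first exact: horiz lk.
  rewrite addbC horiz // 1?link_sym //.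
  by rewrite orbC [(w == t) && _]andbC [(w == s) && _]andbC.
move=> {horiz} /eqP c vx wy /implyP lk.
have cl : close v w by rewrite /close c leqnSn.
case/existsP: (lk cl) => b /andP [_ /and3P [+ _ _]].
rewrite c eqxx => /= /andP [/eqP e1 /eqP e2].
rewrite /twist_flip c ltnn.
case: (w.2 =P n) => [wn|wn].
  have ex : x.2 = v.1 by case/and3P: vx => _ _; rewrite c wn eqxx => /eqP.
  have ey : y.2 = w.1 by case/and3P: wy => _ _; rewrite wn eqxx => /eqP.
  have eb : x.1 (+) y.1 = true.
    by rewrite e1 -e2 ex ey; case: v.1 w.1 ne => [] [].
  have -> : y.1 = ~~ x.1 by move: eb; case: x.1 y.1 => [] [].
  rewrite !addbF; case: x.1; 
  case: s t v w {e1 e2 ex ey eb cl lk vx wy} hs ht st lv lw c ne wn => [s1 s2] [t1 t2] [v1 v2] [w1 w2];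
  rewrite /on_ladder /ladder_adj /differ_by_one /= => hs ht st lv lw -> ne ->;
  rewrite !xpair_eqE;
  case: s1 t1 v1 w1 ne hs ht st {lv lw} => [] [] [] [] //= _; lia.
have -> : y.1 = b (+) x.1 by rewrite -e1 addbAC addbb.
have -> : y.2 = b (+) x.2 by rewrite -e2 addbAC addbb.
set A := (_ && (_ < _)); set B := (_ && (_ <= _)).
set A' := (_ && (_ < _)); set B' := (_ && (_ <= _)).
transitivity (A (+) B (+) A' (+) B').
  by case: b x.1 x.2 (A) (B) (A') (B') {e1 e2 lk} => [] [] [] [] [] [] [].
rewrite /A /B /A' /B' {A B A' B'}.
case: s t v w {e1 e2 cl lk vx wy} hs ht st lv lw c ne wn => [s1 s2] [t1 t2] [v1 v2] [w1 w2].
rewrite /on_ladder /ladder_adj /differ_by_one /= => hs ht st lv lw -> ne wn.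
rewrite !xpair_eqE.
case: s1 t1 v1 w1 ne hs ht st {lv lw} => [] [] [] [] //= _; lia.
Qed.

(** * The grid *)

Definition grid_coord (n : nat) (v : grid_vertex n) : bool * nat :=
  if v is Some (i, j) then (i == 1 :> nat, j.+1) else (false, 0).

Lemma grid_coord_on_ladder n (v : grid_vertex n) : on_ladder n (grid_coord v).
Proof.
by case: v => [[i j]|]; rewrite /on_ladder //= ltn_ord andbT; case: (_ == 1).
Qed.

Lemma grid_coord_inj n : injective (@grid_coord n).
Proof.
move=> [[[i i2] j]|] [[[i' i2'] j']|] //= [] e /val_inj ->; congr (Some (_, _)).
by apply/val_inj => /=; move: i i' i2 i2' e => [|[|?]] [|[|?]].
Qed.

Lemma grid_coord_surj n p : 0 < n -> on_ladder n p -> exists v : grid_vertex n, grid_coord v = p.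
Proof.
case: p => [r [|c]]; rewrite /on_ladder /= => n0.
  by case: r => // _; exists None.
case/andP=> _ cn; exists (Some (inord r, Ordinal cn)) => /=.
by rewrite inordK; case: r.
Qed.

(** In column 0 of row [false], the pendant edge becomes an ordinary row edge. *)
Lemma grid_adj_coord n (v w : grid_vertex n) :
  grid_adj v w = ladder_adj (grid_coord v) (grid_coord w).
Proof.
case: v w => [[[i i2] j]|] [[[i' i2'] j']|] //=; rewrite /ladder_adj /differ_by_one /=.
- rewrite -!val_eqE /=.
  by move: i i' i2 i2' => [|[|?]] [|[|?]] //= _ _; lia.
- by move: i i2 => [|[|?]] //= _; lia.
- by move: i' i2' => [|[|?]] //= _; lia.
Qed.

Lemma count_le1 (T : eqType) (P : pred T) (s : seq T) :
  uniq s -> {in s &, forall x y, P x -> P y -> x = y} -> count P s = has P s.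
Proof.
elim: s => //= x s IH /andP [xs us] inj; rewrite IH //; last first.
  by move=> y z ys zs; apply: inj; rewrite inE ?ys ?zs orbT.
case: (boolP (P x)) => //= Px; case: hasP => // -[y ys Py].
by move: xs; rewrite (inj x y) ?inE ?eqxx ?ys ?orbT.
Qed.

Lemma odd_count_if3 (T : Type) (P Q : pred T) (a b c : bool) (s : seq T) :
  (forall w, ~~ (P w && Q w)) ->
  odd (count (fun w => if P w then a else if Q w then b else c) s) =
  (a && odd (count P s)) (+) (b && odd (count Q s))
    (+) (c && odd (count (fun w => ~~ P w && ~~ Q w) s)).
Proof.
move=> disj; elim: s => [|w s IH] /=; first by rewrite !andbF.
rewrite !oddD !oddb IH; move: (disj w).
case: (P w) (Q w) => [] [] // _;
by case: a b c {IH} (odd _) (odd _) (odd _) => [] [] [] [] [] [].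
Qed.

(** * Gadget translations and the twisted edge *)

Section Twist.

Variables (n : nat) (nb : grid_vertex n -> seq (grid_vertex n)).
Hypotheses (n0 : 0 < n) (nbP : edge_ordering (@grid_adj n) nb).
Variables (s t : grid_vertex n).
Hypothesis (st : grid_adj s t).

Definition vertex_flip (x : bool * bool) (v w : grid_vertex n) : bool :=
  twist_flip n (grid_coord s) (grid_coord t) x (grid_coord v) (grid_coord w).

(** Reduces counting the neighbours in one direction, of which there is at most one, to arithmetic
    on coordinates. *)
Lemma count_nb v (P : pred (bool * nat)) (b : bool) :
  (forall p q, ladder_adj (grid_coord v) p -> ladder_adj (grid_coord v) q ->
     P p -> P q -> p = q) ->
  (forall p, on_ladder n (grid_coord v) -> on_ladder n p ->
     ladder_adj (grid_coord v) p -> P p -> b) ->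
  (on_ladder n (grid_coord v) -> b ->
     exists p, [&& on_ladder n p, ladder_adj (grid_coord v) p & P p]) ->
  count (fun w => P (grid_coord w)) (nb v) = b.
Proof.
move=> inj only ex; have [us mem] := nbP v.
rewrite count_le1 //; last first.
  move=> w w'; rewrite !mem /in_mem /= !grid_adj_coord => aw aw' Pw Pw'.
  exact/grid_coord_inj/inj.
congr nat_of_bool; apply/hasP/idP => [[w]|/(ex (grid_coord_on_ladder v)) [p]].
  rewrite mem /in_mem /= grid_adj_coord.
  exact: only (grid_coord_on_ladder v) (grid_coord_on_ladder w).
case/and3P=> op; have [w <-] := grid_coord_surj n0 op => aw Pw; exists w => //.
by rewrite mem /in_mem /= grid_adj_coord.
Qed.

Lemma count_nb_left v :
  count (fun w => (grid_coord w).2 < (grid_coord v).2) (nb v) =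
    ((grid_coord v).1 < (grid_coord v).2).
Proof.
apply: (@count_nb v (fun p => p.2 < (grid_coord v).2)); move: (grid_coord v) => [r c];
  rewrite /on_ladder /ladder_adj /differ_by_one /=.
- by move=> [r1 c1] [r2 c2]; case: r r1 r2 => [] [] [] /=; move=> *;
    congr (_, _); lia.
- by move=> [r1 c1]; case: r r1 => [] [] /=; lia.
- by move=> o lt; exists (r, c.-1); rewrite /= eqxx; case: r o lt => /=; lia.
Qed.

Lemma count_nb_right v :
  count (fun w => (grid_coord v).2 < (grid_coord w).2) (nb v) = ((grid_coord v).2 < n).
Proof.
apply: (@count_nb v (fun p => (grid_coord v).2 < p.2)); move: (grid_coord v) => [r c];
  rewrite /on_ladder /ladder_adj /differ_by_one /=.
- by move=> [r1 c1] [r2 c2]; case: r r1 r2 => [] [] [] /=; move=> *;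
    congr (_, _); lia.
- by move=> [r1 c1]; case: r r1 => [] [] /=; lia.
- by move=> o lt; exists (r, c.+1); rewrite /= eqxx; case: r o lt => /=; lia.
Qed.

Lemma count_nb_vertical v :
  count (fun w => ~~ ((grid_coord w).2 < (grid_coord v).2) && ~~ ((grid_coord v).2 < (grid_coord w).2))
    (nb v) = (0 < (grid_coord v).2).
Proof.
apply: (@count_nb v (fun p => ~~ (p.2 < (grid_coord v).2) && ~~ ((grid_coord v).2 < p.2)));
  move: (grid_coord v) => [r c]; rewrite /on_ladder /ladder_adj /differ_by_one /=.
- by move=> [r1 c1] [r2 c2]; case: r r1 r2 => [] [] [] /=; move=> *;
    congr (_, _); lia.
- by move=> [r1 c1]; case: r r1 => [] [] /=; lia.
- by move=> o lt; exists (~~ r, c); rewrite /=; case: r o lt => /=; lia.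
Qed.

(** The left, right and vertical flips sum to [l + r + (l + r) = 0]; where a left or right neighbour
    is missing, its flip vanishes. *)
Lemma vertex_flip_even x v :
  valid n (grid_coord v) x -> ~~ odd (count (vertex_flip x v) (nb v)).
Proof.
move=> vx; rewrite /vertex_flip /twist_flip odd_count_if3; last by move=> w; lia.
rewrite count_nb_left count_nb_right count_nb_vertical !oddb.
have := grid_coord_on_ladder v; have := grid_coord_on_ladder s; have := grid_coord_on_ladder t.
move: st vx; rewrite grid_adj_coord.
move: (grid_coord s) (grid_coord t) (grid_coord v) x => [s1 s2] [t1 t2] [v1 v2] [x1 x2].
rewrite /valid /on_ladder /ladder_adj /differ_by_one /=.
case: (posnP v2) => [->|v0].
  case: v1 => //; rewrite !andbF n0 (ltn_eqF n0) andbT /= => + /and3P [_ /negbTE -> _] + + _.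
  by case: s1 t1 => [] [] //=; lia.
move=> adj /and3P [xl _ _] ht hs hv; set l := x1 (+) _; set r := if _ then _ else _.
have -> : r && (v2 < n) = r.
  rewrite ltn_neqAle /r; case: (v2 == n) => //=.
  by case/andP: hv => _ ->; rewrite andbT.
have -> : l && (v1 < v2) = l.
  rewrite /l; case: (ltnP v1 v2) => lv; first by rewrite andbT.
  have v1t : v1 by move: lv v0; case: (v1) => //=; lia.
  rewrite andbF; apply/esym/negbTE; rewrite v1t.
  have v21 : v2 = 1 by move: lv v0; rewrite v1t /=; lia.
  move: xl; rewrite v21 => /negbTE -> /=.
  by move: adj ht hs; clear l r; case: s1 t1 => [] [] /=; lia.
by rewrite andbT addbb.
Qed.

(** Over one base vertex the link forces [x = y], so a single injection moves both vertices; across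
    a base edge [twist_flip_edge] applies. *)
Lemma flip_pair_iso r (a b : cfi_vertex nb) (x y : bool * bool) :
  valid n (grid_coord (cfi_base a)) x -> valid n (grid_coord (cfi_base b)) y ->
  link n r (grid_coord (cfi_base a)) x (grid_coord (cfi_base b)) y ->
  pair_iso (cfi_adj (@grid_adj n) (nb:=nb)) (twisted_cfi_adj (@grid_adj n) (nb:=nb) s t)
    a b (flip (vertex_flip x) a) (flip (vertex_flip y) b).
Proof.
move=> vx vy lk; split.
  case: (cfi_base a =P cfi_base b) => [e|ne]; last first.
    by rewrite !(introF eqP) // => e; apply: ne; rewrite ?e // -(base_flip (vertex_flip x)) e base_flip.
  have -> : x = y.
    move: lk; rewrite e => /implyP lk.
    have cl : close (grid_coord (cfi_base b)) (grid_coord (cfi_base b)) by rewrite /close leqnSn.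
    case/existsP: (lk cl) => -[]; rewrite /side_ok eqxx //= => /and3P [+ _ _].
    rewrite eqxx /= => /andP []; case: (x) (y) => x1 x2 [y1 y2] /=.
    by case: x1 x2 y1 y2 => [] [] [] [].
  by rewrite (inj_eq (inv_inj (flipK _))).
rewrite /twisted_cfi_adj /between_gadgets /cfi_adj !base_flip.
case: (boolP (grid_adj _ _)) => [ab|nab] /=; last first.
  rewrite ifF //; apply: contraNF nab => /orP [] /andP [/eqP -> /eqP ->] //.
  by rewrite grid_adj_sym.
have ab' : grid_adj (cfi_base b) (cfi_base a) by rewrite grid_adj_sym.
rewrite !bit_flip ?vertex_flip_even ?(nbP _).2 //.
move: (st) (ab); rewrite grid_adj_coord => st'; rewrite grid_adj_coord => ab''.
have := twist_flip_edge (grid_coord_on_ladder s) (grid_coord_on_ladder t) st'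
  (grid_coord_on_ladder _) (grid_coord_on_ladder _) ab'' vx vy lk.
rewrite -/(vertex_flip x _ _) -/(vertex_flip y _ _) !(inj_eq (@grid_coord_inj n)) => <-.
by case: (vertex_flip _ _ _) (vertex_flip _ _ _) (cfi_bit _ _) (cfi_bit _ _) => [] [] [] [].
Qed.

End Twist.

(** * The game *)

Lemma ordS_lt k (j : 'I_k.+1) : j < k -> ordS j = inord j.+1.
Proof. by move=> jk; apply/val_inj; rewrite /= inordK ?ltnS ?modn_small. Qed.

Lemma ordS_max k : ordS (@ord_max k) = ord0.
Proof. by apply/val_inj; rewrite /= modnn. Qed.

Section Game.

Variables (k n : nat) (nb : grid_vertex n -> seq (grid_vertex n)).
Hypotheses (k1 : 1 < k) (n0 : 0 < n) (nbP : edge_ordering (@grid_adj n) nb).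
Variables (s t : grid_vertex n).
Hypothesis (st : grid_adj s t).

Notation vertex := (cfi_vertex nb).
Notation pos := (position k vertex vertex).
Notation bits := {ffun 'I_k.+1 -> bool * bool}.
Notation flip_by x := (flip (vertex_flip s t x)).

Implicit Types (p : pos) (u : k.-1.-tuple vertex) (D : bits).

Definition safe (r : nat) (p : pos) : Prop :=
  exists D : bits,
    (forall j a b, p j = Some (a, b) ->
       b = flip_by (D j) a /\ valid n (grid_coord (cfi_base a)) (D j)) /\
    (forall j a b a' b', p j = Some (a, b) -> p (ordS j) = Some (a', b') ->
       link n r (grid_coord (cfi_base a)) (D j) (grid_coord (cfi_base a')) (D (ordS j))).

(* A last pebble that is beside the graphs is treated as a copy of the first. *)
Definition walk_base (p : pos) (g : k.-1.-tuple (grid_vertex n)) (j : 'I_k.+1) :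
    grid_vertex n :=
  if 0 < j < k then nth None g j.-1
  else if p j is Some (a, _) then cfi_base a
  else if p ord0 is Some (a, _) then cfi_base a else None.

Definition answers (r : nat) (p : pos) (g : k.-1.-tuple (grid_vertex n)) (D : bits) :
    bool :=
  [&& [forall j, if p j is Some (a, b) then b == flip_by (D j) a else true],
      [forall j, valid n (grid_coord (walk_base p g j)) (D j)]
    & [forall j, link n r (grid_coord (walk_base p g j)) (D j)
                   (grid_coord (walk_base p g (ordS j))) (D (ordS j))]].

Definition answer r p g : bits := odflt [ffun=> (false, false)] [pick D | answers r p g D].

Definition flip_all (D : bits) (u : k.-1.-tuple vertex) : k.-1.-tuple vertex :=
  [tuple flip_by (D (inord i.+1)) (tnth u i) | i < k.-1].

Definition bases (u : k.-1.-tuple vertex) : k.-1.-tuple (grid_vertex n) :=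
  [tuple of [seq cfi_base x | x <- u]].

(** The bits depend on [u] only through its base vertices, which flipping preserves, so the map is
    an involution. Since [h] already contains the position before the current round, the budget is
    the one left after that round. *)
Definition twist_hiding : strategy k vertex vertex := fun h p u =>
  flip_all (answer (n./2 - 2 - size h) p (bases u)) u.

Lemma bases_flip_all D u : bases (flip_all D u) = bases u.
Proof. by apply: eq_from_tnth => i; rewrite !tnth_map tnth_ord_tuple base_flip. Qed.

Lemma flip_allK D : involutive (flip_all D).
Proof. by move=> u; apply: eq_from_tnth => i; rewrite !tnth_mktuple flipK. Qed.

Lemma twist_hiding_bij h p : bijective (twist_hiding h p).
Proof.
by exists (twist_hiding h p) => u; rewrite /twist_hiding bases_flip_all flip_allK.
Qed.

Lemma place_flip_all p u D j a b :
  (forall i a' b', p i = Some (a', b') -> b' = flip_by (D i) a') ->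
  place p u (flip_all D u) j = Some (a, b) ->
  b = flip_by (D j) a /\ walk_base p (bases u) j = cfi_base a.
Proof.
move=> agree; rewrite /place ffunE /walk_base; case: ifP => [/andP [j0 jk]|_]; last first.
  by move=> pj; rewrite (agree _ _ _ pj) pj.
have jk1 : j.-1 < k.-1 by rewrite -ltnS !prednK // (ltn_trans j0).
rewrite onthE (nth_map (a, b)) ?size_zip ?size_tuple ?minnn // nth_zip ?size_tuple //.
rewrite (_ : j.-1 = Ordinal jk1) // -!tnth_nth tnth_mktuple => -[ea <-].
rewrite tnth_map ea; split=> //; congr (flip (vertex_flip _ _ (D _)) _).
by apply/val_inj; rewrite /= inordK prednK // ltnW.
Qed.

Lemma answers_safe r p u D :
  answers r p (bases u) D -> safe r (place p u (flip_all D u)).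
Proof.
case/and3P => /forallP agree /forallP val_D /forallP lnk; exists D.
have agree' i a' b' : p i = Some (a', b') -> b' = flip_by (D i) a'.
  by move=> pi; apply/eqP; move: (agree i); rewrite pi.
split=> [j a b|j a b a' b'] pj.
  by have [-> <-] := place_flip_all agree' pj; split.
move=> pj'; have [_ <-] := place_flip_all agree' pj.
by have [_ <-] := place_flip_all agree' pj'.
Qed.

Lemma ends_answered r (p : pos) g x y :
  r.+2 < n./2 ->
  valid n (grid_coord (walk_base p g ord0)) x ->
  valid n (grid_coord (walk_base p g ord_max)) y ->
  link n r.+1 (grid_coord (walk_base p g ord0)) x (grid_coord (walk_base p g ord_max)) y ->
  (forall j a b, p j = Some (a, b) ->
     j = ord0 /\ b = flip_by x a \/ j = ord_max /\ b = flip_by y a) ->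
  exists D, answers r p g D.
Proof.
move=> hr vx vy lk agree.
have i0 : inord 0 = ord0 :> 'I_k.+1 by apply/val_inj; rewrite /= inordK.
have ik : inord k = ord_max :> 'I_k.+1 by apply/val_inj; rewrite /= inordK.
have [] := @walk_response n r k (fun i => grid_coord (walk_base p g (inord i))) x y hr.
- by move=> i; have /andP [] := grid_coord_on_ladder (walk_base p g (inord i)).
- by rewrite i0.
- by rewrite ik.
- by rewrite i0 ik.
move=> D [D0 Dk vD lD]; exists [ffun j : 'I_k.+1 => D j].
apply/and3P; split; apply/forallP => j; rewrite !ffunE.
- case pj: (p j) => [[a b]|] //; apply/eqP.
  by case: (agree j a b pj) => -[-> ->] /=; rewrite ?D0 ?Dk.
- by move: (vD j); rewrite inord_val.
- case: (ltnP j k) => [jk|kj].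
    by move: (lD j jk); rewrite -ordS_lt // inord_val /= modn_small.
  (* The closing step of the cycle is the old link, read backwards and weakened. *)
  have -> : j = ord_max by apply/val_inj/eqP; rewrite eqn_leq kj leq_ord.
  by rewrite ordS_max /= D0 Dk link_sym link_weaken.
Qed.

Lemma answer_spec r p p' g :
  r.+2 < n./2 -> safe r.+1 p -> spoiler_picks p p' -> answers r p' g (answer r p' g).
Proof.
move=> hr sp pick; rewrite /answer; case: pickP => //= none.
suff [D ans] : exists D, answers r p' g D by rewrite none in ans.
case: pick => [[p_no ->]|[i pi ->]].
  (* With no pebbles placed, the walk is taken to start and end at the pendant vertex, with zero
     bits. *)
  have base_out (j : 'I_k.+1) : ~~ (0 < j < k) -> walk_base p g j = None.
    by rewrite /walk_base p_no !ffunE => /negbTE ->.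
  apply: (@ends_answered _ _ _ (false, false) (false, false)) => //;
    rewrite ?base_out ?ltnn ?andbF //=.
  - by rewrite /valid /= (ltn_eqF n0).
  - by rewrite /valid /= (ltn_eqF n0).
  - exact: link_refl.
  - by move=> j a b; rewrite p_no ffunE.
have k0 : 0 < k by apply: ltnW.
case: sp => D [sD lD]; case ei: (p i) pi => [[a b]|] // _.
have k_0 : (@ord_max k == ord0) = false by rewrite -val_eqE /= (gtn_eqF k0).
have e0 : keep_pair p i ord0 = Some (a, b) by rewrite ffunE eqxx.
have ek : keep_pair p i ord_max = p (ordS i) by rewrite ffunE k_0 eqxx.
have b0 : walk_base (keep_pair p i) g ord0 = cfi_base a by rewrite /walk_base /= e0.
have [eb va] := sD i a b ei.
pose y := if p (ordS i) is Some _ then D (ordS i) else D i.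
apply: (@ends_answered _ _ _ (D i) y) => //.
- by rewrite b0.
- rewrite /walk_base /= ltnn andbF ek e0 /y.
  by case ey: (p (ordS i)) => [[a' b']|] //; case: (sD _ _ _ ey).
- rewrite b0 /walk_base /= ltnn andbF ek e0 /y.
  case ey: (p (ordS i)) => [[a' b']|]; last exact: link_refl.
  exact: lD ei ey.
move=> j a' b'; rewrite ffunE; case: (j =P ord0) => [-> |_].
  by rewrite ei => -[<- <-]; left.
case: eqP => [-> |//] ey; right; rewrite /y ey; split=> //.
by case: (sD _ _ _ ey).
Qed.

Lemma twist_hiding_safe h p : play twist_hiding h p ->
  size h <= n./2 - 2 -> safe (n./2 - 2 - size h) p.
Proof.
elim=> [_|{}h {}p p' u pl IH picks le].
  by exists [ffun=> (false, false)]; split=> [j a b|j a b a' b']; rewrite ffunE.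
apply: answers_safe; apply: answer_spec picks; first by move: le => /=; lia.
have -> : (n./2 - 2 - size (p :: h)).+1 = n./2 - 2 - size h by move: le => /=; lia.
by apply: IH; apply: ltnW.
Qed.

Lemma safe_not_won r p : safe r p ->
  ~ spoiler_won (cfi_adj (@grid_adj n) (nb := nb))
      (twisted_cfi_adj (@grid_adj n) (nb := nb) s t) p.
Proof.
case=> D [sD lD] [i [a [b [a' [b' [pa pb]]]]]]; apply.
have [-> va] := sD _ _ _ pa; have [-> vb] := sD _ _ _ pb.
exact: (flip_pair_iso n0 nbP st va vb (lD _ _ _ _ _ pa pb)).
Qed.

End Game.

Theorem theorem26 :
  exists c : rat, (0 < c)%R /\
    forall (k n : nat), 2 <= k -> 3 <= n ->
    forall (nb : grid_vertex n -> seq (grid_vertex n)),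
      edge_ordering (@grid_adj n) nb ->
    forall (s t : grid_vertex n), grid_adj s t ->
      duplicator_survives k
        (@cfi_adj _ (@grid_adj n) nb)
        (@twisted_cfi_adj _ (@grid_adj n) nb s t)
        (c * n%:R)%R.
Proof.
(* The strategy lasts [n./2 - 2] rounds, which is at least [n / 8] once [n >= 8]; for smaller [n]
   only round 0 is claimed. *)
exists (8%:R^-1)%R; split=> // k n k2 n3 nb nbP s t st; split=> //.
have n0 : 0 < n by apply: leq_trans n3.
exists (twist_hiding s t) => [h p|h p pl le]; first exact: twist_hiding_bij.
have le' : 8 * size h <= n.
  by rewrite -(Num.Theory.ler_nat rat) GRing.natrM; move: le; lra.
apply: (safe_not_won n0 nbP st); apply: (twist_hiding_safe k2 n0 st pl).
by move: le' n3; clear; lia.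
Qed.
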